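(* Let $\lambda^0$ be a (non-empty) Young diagram with interlacing coordinates $a_0<b_1<a_1<\dots<b_m<a_m$, and let $\eta=1/\sqrt{|\lambda^0|}$. In the liquid region $L$, the function $U_c=U_c(x,t)$ satisfies the partial differential equation $$(U_c)_t+U_c\,\frac{(U_c)_x+1}{1-t}=0,$$ where the indices $x$ and $t$ denote partial derivatives.
   Context: The Young diagram of a partition $\lambda=(\lambda_1\ge\dots\ge\lambda_l>0)$ (size $|\lambda|=\sum\lambda_i$) is drawn in Russian convention: for $1\le i\le l$, $1\le j\le\lambda_i$ there is a square box of area $2$ with sides parallel to $y=\pm x$ and centre $(j-i,i+j-1)$. Its upper boundary is the graph of a $1$-Lipschitz function $\omega_\lambda$ with $\omega_\lambda(x)=|x|$ for $|x|$ large; the interlacing coordinates are the integers $a_0<b_1<a_1<\dots<b_m<a_m$ such that the $a_i$ are the local minima and the $b_i$ the local maxima of $\omega_\lambda$ (they satisfy $\sum_{i=0}^m a_i=\sum_{i=1}^m b_i$). For $(x,t)\in[\eta a_0,\eta a_m]\times[0,1]$ the critical equation, in the complex unknown $U$, is $$U\prod_{i=1}^m(x-\eta b_i+U)=(1-t)\prod_{i=0}^m(x-\eta a_i+U).$$ It has either $0$ or exactly $2$ non-real solutions. The liquid region $L$ is the set of $(x,t)$ for which it has two non-real solutions, and $U_c(x,t)$ is then the unique solution with positive imaginary part. *)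

(* Defs.v *)
From mathcomp Require Import all_boot all_order all_algebra.
From mathcomp Require Import complex.
From mathcomp Require Import all_classical all_reals all_analysis.

Set Implicit Arguments.
Unset Strict Implicit.
Unset Printing Implicit Defensive.

Import Order.TTheory GRing.Theory Num.Theory numFieldNormedType.Exports.
Local Open Scope classical_set_scope.
Local Open Scope ring_scope.

Definition is_partition (la : seq nat) : bool := sorted geq la && (0%N \notin la).

Section RussianDiagram.
Context {R : realType}.

(* A square of area 2 with sides parallel to y = x and y = -x is an l^1-ball of
   radius 1. *)
Definition box (i j : nat) : set (R * R) :=
  [set p | `|p.1 - (j%:R - i%:R)| + `|p.2 - (i%:R + j%:R - 1)| <= 1].

(* Rows and columns are numbered from 1, while [nth] counts from 0. *)
Definition young_diagram (la : seq nat) : set (R * R) :=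
  [set p | exists i j : nat,
     [/\ (1 <= i <= size la)%N, (1 <= j <= nth 0%N la i.-1)%N & box i j p]].

(* The singleton gives omega x = |x| at abscissas that no box meets; boxes lie
   in the cone |x| <= y, so it changes nothing elsewhere. *)
Definition omega (la : seq nat) (x : R) : R :=
  sup ([set `|x|] `|` [set y | young_diagram la (x, y)]).

Definition local_min (f : R -> R) (z : R) : Prop := \forall y \near z, f z <= f y.
Definition local_max (f : R -> R) (z : R) : Prop := \forall y \near z, f y <= f z.

End RussianDiagram.

(* The local maxima b_1, ..., b_m are indexed from 0: the mathematical b_(i+1)
   is [b i], lying between [a i] and [a i.+1]. *)
Definition interlacing_coordinates (R : realType) (la : seq nat) (m : nat)
    (a : 'I_m.+1 -> int) (b : 'I_m -> int) : Prop :=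
  [/\ forall i : 'I_m, a (widen_ord (leqnSn m) i) < b i < a (lift ord0 i),
      forall z : R, local_min (omega la) z <-> exists i, z = (a i)%:~R &
      forall z : R, local_max (omega la) z <-> exists i, z = (b i)%:~R].

Definition scaling (R : realType) (la : seq nat) : R :=
  (Num.sqrt (sumn la)%:R)^-1.

Section CriticalEquation.
Context {R : realType} (eta : R) {m : nat} (a : 'I_m.+1 -> int) (b : 'I_m -> int).

Definition critical_equation (x t : R) (U : R[i]) : Prop :=
  U * \prod_(i < m) ((x - eta * (b i)%:~R)%:C%C + U) =
  (1 - t)%:C%C * \prod_(i < m.+1) ((x - eta * (a i)%:~R)%:C%C + U).

Definition nonreal_solution (x t : R) (U : R[i]) : Prop :=
  critical_equation x t U /\ complex.Im U != 0.

Definition liquid_region : set (R * R) :=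
  [set p | [/\ eta * (a ord0)%:~R <= p.1 <= eta * (a ord_max)%:~R,
               0 <= p.2 <= 1 &
               exists U V : R[i],
                 [/\ U != V, nonreal_solution p.1 p.2 U,
                     nonreal_solution p.1 p.2 V &
                     forall W, nonreal_solution p.1 p.2 W -> W = U \/ W = V]]].

(* Meaningful on the liquid region only, see [critical_rootP]. *)
Definition critical_root (x t : R) : R[i] :=
  xget 0 [set U | critical_equation x t U /\ 0 < complex.Im U].

Lemma critical_equation_conj (x t : R) (U : R[i]) :
  critical_equation x t U -> critical_equation x t (conjc U).
Proof.
pose f : {rmorphism R[i] -> R[i]} := @conjc R.
have fR (r : R) : f r%:C%C = r%:C%C by rewrite /f /= oppr0.
have fP n (F : 'I_n -> R) :
    f (\prod_(i < n) ((F i)%:C%C + U)) = \prod_(i < n) ((F i)%:C%C + f U).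
  by rewrite rmorph_prod; apply: eq_bigr => i _; rewrite rmorphD fR.
by move=> /(congr1 f); rewrite !rmorphM !fP fR.
Qed.

Lemma critical_rootP (x t : R) : liquid_region (x, t) ->
  unique (fun U => critical_equation x t U /\ 0 < complex.Im U)
         (critical_root x t).
Proof.
have neg (U : R[i]) : complex.Im (conjc U) = - complex.Im U by case: U.
move=> [_ _ [U [V [_ [eU nU] _ UV]]]] /=.
have [W PW] : exists W, critical_equation x t W /\ 0 < complex.Im W.
  move: nU; rewrite neq_lt => /orP[ltU|]; last by exists U.
  exists (conjc U); split; first exact: critical_equation_conj.
  by rewrite neg oppr_gt0.
have uniqP W1 W2 : critical_equation x t W1 /\ 0 < complex.Im W1 ->
    critical_equation x t W2 /\ 0 < complex.Im W2 -> W1 = W2.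
  move=> [e1 p1] [e2 p2].
  have n1 := UV W1 (conj e1 (lt0r_neq0 p1)).
  have n2 := UV W2 (conj e2 (lt0r_neq0 p2)).
  have n3 : conjc W1 = U \/ conjc W1 = V.
    apply: UV; split; first exact: critical_equation_conj.
    by rewrite neg oppr_eq0 lt0r_neq0.
  have D (A B : R[i]) : 0 < complex.Im A -> 0 < complex.Im B -> A <> conjc B.
    move=> pA pB AB; have := pA; rewrite AB neg oppr_gt0 => /(lt_trans pB).
    by rewrite ltxx.
  have d1 := D _ _ p1 p1; have d2 := D _ _ p2 p1.
  by case: n1 => E1; case: n2 => E2; case: n3 => E3; congruence.
have PC : [set U | critical_equation x t U /\ 0 < complex.Im U]
            (critical_root x t) by apply: (xgetPex 0); exists W.
by split=> // W' PW'; apply: uniqP.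
Qed.

End CriticalEquation.

(* The library has no normed R-module structure on R[i]; differentiation of a
   complex function of a real variable is done on real and imaginary parts. *)
Definition cderivable (R : realType) (f : R -> R[i]) (x : R) : Prop :=
  derivable (fun y => complex.Re (f y)) x 1 /\
  derivable (fun y => complex.Im (f y)) x 1.

Definition cderive (R : realType) (f : R -> R[i]) (x : R) : R[i] :=
  Complex (derive1 (fun y => complex.Re (f y)) x)
          (derive1 (fun y => complex.Im (f y)) x).

(* Main.v *)
Require Import Defs.
From mathcomp Require Import all_boot all_order all_algebra.
From mathcomp Require Import complex ring lra zify.
From mathcomp Require Import all_classical all_reals all_analysis.

Set Implicit Arguments.
Unset Strict Implicit.
Unset Printing Implicit Defensive.

Import Order.TTheory GRing.Theory Num.Theory numFieldNormedType.Exports.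
Local Open Scope classical_set_scope.
Local Open Scope ring_scope.

(* Put z = x + U, with a_i, b_i scaled by eta. Interlacing makes the partial
   fraction expansion
     prod (z - a_i) / prod (z - b_i) = G z := z - k - sum c_i / (z - b_i)
   have weights c_i > 0, and the critical equation becomes z - x = (1 - t) G z.
   With H z w := 1 + sum c_i / ((z - b_i) (w - b_i)) one has
   G z - G w = (z - w) H z w. A solution z in the upper half-plane and its
   conjugate give (1 - t) H z z^* = 1. If z and w are both such solutions and
   (1 - t) H z w = 1, then, with u_i = 1 / (z - b_i), v_i = 1 / (w - b_i),
     sum c_i |u_i - v_i^*|^2 = H z z^* + H w w^* - H z w - (H z w)^* = 0,
   so z = w^*, which is impossible. Hence the solution is unique (z <> w) and
   simple (z = w). It depends continuously on (x, t), because a polynomial that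
   is small at a point has a root nearby, and the identity for G z - G w gives
   the difference quotients: with D = 1 - (1 - t) G' z, U_x + 1 = 1 / D and
   U_t = - G z / D. The equation is then U = (1 - t) G z. *)

(** * Partial fractions of a ratio of products *)

(** Both sides agree at the [m] distinct points [be i], and [k] brings the degree of their
    difference below [m], so the difference vanishes. The coefficients are the residues of the ratio
    at the [be i]. *)
Lemma partial_fractions (F : fieldType) m (al : 'I_m.+1 -> F) (be : 'I_m -> F) :
  injective be ->
  exists k, \prod_i ('X - (al i)%:P) =
    ('X - k%:P) * \prod_i ('X - (be i)%:P) +
    \sum_i (\prod_j (be i - al j) / \prod_(j | j != i) (be i - be j)) *:
           \prod_(j | j != i) ('X - (be j)%:P).
Proof.
move=> inj_be; set p := \prod_i ('X - (al i)%:P).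
set q := \prod_i ('X - (be i)%:P); set s := \sum_i _.
have sp : size p = m.+2.
  by rewrite size_prod_XsubC /index_enum -enumT size_enum_ord.
have sq : size q = m.+1.
  by rewrite size_prod_XsubC /index_enum -enumT size_enum_ord.
have mp : p \is monic by apply: monic_prod_XsubC.
have mq : q \is monic by apply: monic_prod_XsubC.
have sXq : size ('X * q) = m.+2 by rewrite mulrC size_mulX ?monic_neq0// sq.
have ss : (size s <= m)%N.
  apply: (leq_trans (size_sum _ _ _)); apply/bigmax_leqP => i _.
  apply: (leq_trans (size_scale_leq _ _)).
  rewrite size_prod => [|j _]; last by rewrite polyXsubC_eq0.
  rewrite (eq_bigr (fun=> 2%N)) => [|j _]; last by rewrite size_XsubC.
  rewrite sum_nat_const (cardC1 i) card_ord.
  by case: m {al be inj_be p q s sp sq mp mq sXq} i => [[]//|n _] /=; lia.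
(* Both [p] and ['X * q] are monic of degree m + 1, so their difference has degree at most m; since
   [q] is monic, adding [k] times [q] cancels its coefficient of degree m. *)
pose k := - (p - 'X * q)`_m; exists k.
apply/eqP; rewrite -subr_eq0; apply/eqP.
apply: (@roots_geq_poly_eq0 _ _ [seq be i | i <- enum 'I_m]).
- apply/allP => _ /mapP[i _ ->].
  have pE : p.[be i] = \prod_j (be i - al j).
    by rewrite horner_prod; apply: eq_bigr => j _; rewrite !hornerE.
  have qE : q.[be i] = 0.
    by rewrite horner_prod (bigD1 i)//= !hornerE subrr mul0r.
  have sE : s.[be i] = \prod_j (be i - al j).
    rewrite horner_sum (bigD1 i)//= [X in _ + X]big1 => [|j ji]; last first.
      rewrite hornerZ horner_prod [X in _ * X](bigD1 i) 1?eq_sym//=.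
      by rewrite hornerXsubC subrr mul0r mulr0.
    rewrite addr0 hornerZ horner_prod.
    rewrite [X in _ * X](eq_bigr (fun j => be i - be j)) => [|j _]; last first.
      by rewrite !hornerE.
    rewrite divfK//; apply/prodf_neq0 => j ji.
    by rewrite subr_eq0 (inj_eq inj_be) eq_sym.
  by rewrite /root !hornerE pE qE sE mulr0 add0r subrr.
- by rewrite map_inj_uniq// enum_uniq.
- rewrite size_map size_enum_ord.
  have -> : p - (('X - k%:P) * q + s) = (p - 'X * q + k%:P * q) - s by ring.
  apply: (leq_trans (size_polyD _ _)); rewrite size_polyN geq_max ss andbT.
  apply/leq_sizeP => j; rewrite leq_eqVlt => /predU1P[<-|mj].
    have qm : q`_m = 1 by move/monicP: mq; rewrite lead_coefE sq.
    by rewrite coefD coefCM qm mulr1 /k addrN.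
  rewrite coefD coefCM [q`_j]nth_default ?sq// mulr0 addr0 coefB.
  move: mj; rewrite leq_eqVlt => /predU1P[<-|mj].
    move/monicP: mp; rewrite lead_coefE sp => ->.
    have /monicP : 'X * q \is monic by rewrite monicMl ?monicX.
    by rewrite lead_coefE sXq => ->; rewrite subrr.
  by rewrite !nth_default ?subrr ?sp ?sXq.
Qed.

(** * Interlacing and the sign of the residues *)

Section Interlacing.
Context {F : realFieldType} {m : nat} (al : 'I_m.+1 -> F) (be : 'I_m -> F).
Hypothesis ab : forall i, al (widen_ord (leqnSn m) i) < be i < al (lift ord0 i).

Lemma interlacing_le (j k : 'I_m.+1) : (j <= k)%N -> al j <= al k.
Proof.
case: k => k kP /=; elim: k kP => [|k IH] kP.
  by rewrite leqn0 => /eqP j0; rewrite (_ : j = Ordinal kP)//; apply/val_inj.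
rewrite leq_eqVlt => /predU1P[jk|jk].
  by rewrite (_ : j = Ordinal kP)//; apply/val_inj.
have km : (k < m)%N by lia.
apply: (le_trans (IH (ltnW kP) jk)).
have /andP[/lt_trans h /h] := ab (Ordinal km).
by move=> /ltW; congr (al _ <= al _); apply/val_inj.
Qed.

Lemma interlacing_lt (i j : 'I_m) : (i < j)%N -> be i < be j.
Proof.
move=> ij; have /andP[_ /lt_le_trans->//] := ab i.
have /andP[/ltW + _] := ab j; apply: le_trans.
by apply: interlacing_le; rewrite /= /bump.
Qed.

Lemma interlacing_inj : injective be.
Proof.
move=> i j bij; apply/val_inj/eqP; rewrite eqn_leq.
by apply/andP; split; rewrite leqNgt; apply/negP => /interlacing_lt;
  rewrite bij ltxx.
Qed.

(** The two neighbours of [be i] among the [al] contribute one positive and one negative factor.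
    Every other [be j] is paired with its neighbour on the side away from [be i]; both lie on the
    same side of [be i], so their quotient is positive. *)
Lemma prod_interlacing_lt0 (i : 'I_m) :
  \prod_j (be i - al j) / \prod_(j | j != i) (be i - be j) < 0.
Proof.
have E j : al (lift (widen_ord (leqnSn m) i) j) =
    if (j < i)%N then al (widen_ord (leqnSn m) j) else al (lift ord0 j).
  by case: ifP => ji; congr al; apply/val_inj; rewrite /= /bump leqNgt ji.
rewrite (bigD1_ord (widen_ord (leqnSn m) i))//= (bigD1 i)//= E ltnn.
rewrite -mulrA -mulrA -prodfV -big_split/=.
have /andP[ab1 ab2] := ab i.
rewrite pmulr_rlt0 ?subr_gt0// nmulr_rlt0 ?subr_lt0//.
apply: prodr_gt0 => j ji; rewrite E.
have /andP[abj1 abj2] := ab j.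
have [jlti|ilej] := ltnP j i.
  apply: divr_gt0; rewrite subr_gt0 ?interlacing_lt//.
  by apply: le_lt_trans ab1; apply: interlacing_le => /=; exact: ltnW.
have iltj : (i < j)%N by rewrite ltn_neqAle ilej andbT eq_sym.
have bij := interlacing_lt iltj.
rewrite -mulrNN -invrN !opprB.
by rewrite divr_gt0// subr_gt0// (lt_trans bij).
Qed.

End Interlacing.

(** * Rules for complex conjugation *)

Section ConjugateRewriting.
Context {R : rcfType}.
Local Open Scope complex_scope.

(* The [rmorph] lemmas produce [conjc] under a coercion, where [conjc_real] does
   not apply. *)
Lemma conjcD (z w : R[i]) : conjc (z + w) = conjc z + conjc w.
Proof. exact: rmorphD. Qed.

Lemma conjcB (z w : R[i]) : conjc (z - w) = conjc z - conjc w.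
Proof. exact: rmorphB. Qed.

Lemma conjcM (z w : R[i]) : conjc (z * w) = conjc z * conjc w.
Proof. exact: rmorphM. Qed.

Lemma conjc_subr (z : R[i]) (r : R) : conjc (z - r%:C) = conjc z - r%:C.
Proof. by rewrite conjcB conjc_real. Qed.

Lemma conjc_sum m (F : 'I_m -> R[i]) :
  conjc (\sum_i F i) = \sum_i conjc (F i).
Proof. exact: rmorph_sum. Qed.

End ConjugateRewriting.

(** * The function [G] and its solutions in the upper half-plane *)

Section Stieltjes.
Context {R : realType} {m : nat} (k : R) (c be : 'I_m -> R).
Local Open Scope complex_scope.

(** This is [G] of the header: an affine term minus the Stieltjes transform of the measure with mass
    [c i] at [be i]. *)
Definition stieltjes (z : R[i]) : R[i] :=
  z - k%:C - \sum_i (c i)%:C / (z - (be i)%:C).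

(** This is [H] of the header, the divided difference of [G]; on the diagonal it is the derivative
    of [G]. *)
Definition stieltjes_slope (z w : R[i]) : R[i] :=
  1 + \sum_i (c i)%:C / ((z - (be i)%:C) * (w - (be i)%:C)).

Lemma subC_neq0 (z : R[i]) (r : R) : complex.Im z != 0 -> z - r%:C != 0.
Proof. by apply: contra => /eqP/subr0_eq ->. Qed.

Lemma stieltjesB (z w : R[i]) : complex.Im z != 0 -> complex.Im w != 0 ->
  stieltjes z - stieltjes w = (z - w) * stieltjes_slope z w.
Proof.
move=> z0 w0; rewrite /stieltjes /stieltjes_slope mulrDr mulr1 mulr_sumr.
set s := \sum_i _; set s' := \sum_i _.
have -> : z - k%:C - s - (w - k%:C - s') = z - w + (s' - s) by ring.
congr (_ + _); rewrite -sumrB.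
apply: eq_bigr => i _.
by field; rewrite !subC_neq0.
Qed.

Lemma stieltjes_slope_conj (z w : R[i]) :
  conjc (stieltjes_slope z w) = stieltjes_slope (conjc z) (conjc w).
Proof.
rewrite /stieltjes_slope conjcD conjc1 conjc_sum; congr (_ + _).
apply: eq_bigr => i _.
by rewrite conjcM conjc_inv conjcM !conjc_subr conjc_real.
Qed.

(** The critical equation in the unknown z = x + U, divided by the product of the z - [be i]. *)
Definition hodograph (x t : R) (z : R[i]) : Prop :=
  z - x%:C = (1 - t)%:C * stieltjes z.

Lemma hodograph_conj (x t : R) (z : R[i]) :
  hodograph x t z -> hodograph x t (conjc z).
Proof.
move=> /(congr1 conjc); rewrite /hodograph conjc_subr conjcM conjc_real => ->.
rewrite /stieltjes -[in LHS]sumrN conjcD conjc_subr conjc_sum -sumrN.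
congr (_ * (_ + _)); apply: eq_bigr => i _.
by rewrite -!mulNr -rmorphN conjcM conjc_inv conjc_subr conjc_real.
Qed.

(** Subtracting the two equations eliminates [x]; then z - w cancels. *)
Lemma hodograph_slope (x t : R) (z w : R[i]) :
  complex.Im z != 0 -> complex.Im w != 0 -> z != w ->
  hodograph x t z -> hodograph x t w -> (1 - t)%:C * stieltjes_slope z w = 1.
Proof.
move=> z0 w0 zw hz hw; apply: (mulfI (x := z - w)); first by rewrite subr_eq0.
by rewrite mulr1 mulrCA -stieltjesB// mulrBr -hz -hw; ring.
Qed.

Hypothesis c_gt0 : forall i, 0 < c i.

Lemma upper_neq_conj (z w : R[i]) :
  0 < complex.Im z -> 0 < complex.Im w -> z != conjc w.
Proof.
move=> z0 w0; apply/eqP => zw; move: z0.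
by rewrite zw; case: w w0 {zw} => ? ? /=; lra.
Qed.

(** The sum of squares of the header. The case of distinct [z] and [w] yields uniqueness; the case z
    = w yields simplicity, which makes the denominator of the derivatives nonzero. *)
Lemma hodograph_slope_neq1 (x t : R) (z w : R[i]) : t != 0 ->
  0 < complex.Im z -> 0 < complex.Im w ->
  hodograph x t z -> hodograph x t w -> (1 - t)%:C * stieltjes_slope z w != 1.
Proof.
move=> t0 z0 w0 hz hw; apply/eqP => zw1.
have Imc (y : R[i]) : 0 < complex.Im y -> complex.Im (conjc y) != 0.
  by case: y => ? ? /= y0; rewrite oppr_eq0 gt_eqF.
have conj1 y : 0 < complex.Im y -> hodograph x t y ->
    (1 - t)%:C * stieltjes_slope y (conjc y) = 1.
  move=> y0 hy; apply: hodograph_slope hy (hodograph_conj hy).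
  - by rewrite gt_eqF.
  - exact: Imc.
  - exact: upper_neq_conj.
have zw1' : (1 - t)%:C * stieltjes_slope (conjc z) (conjc w) = 1.
  by rewrite -stieltjes_slope_conj -[X in X * _]conjc_real -conjcM zw1 conjc1.
have t1 : (1 - t)%:C != 0.
  apply/eqP => t1; move: zw1.
  by rewrite t1 mul0r => /esym/eqP; rewrite oner_eq0.
pose d i : R[i] := (z - (be i)%:C)^-1 - conjc (w - (be i)%:C)^-1.
have d0 : \sum_i (c i)%:C * (d i * conjc (d i)) = 0.
  have -> : \sum_i (c i)%:C * (d i * conjc (d i)) =
      stieltjes_slope z (conjc z) + stieltjes_slope w (conjc w) -
      stieltjes_slope z w - stieltjes_slope (conjc z) (conjc w).
    rewrite /stieltjes_slope; set s1 := \sum_i _ / (_ * _).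
    set s2 := \sum_i _ / (_ * _); set s3 := \sum_i _ / (_ * _).
    set s4 := \sum_i _ / (_ * _).
    have -> : 1 + s1 + (1 + s2) - (1 + s3) - (1 + s4) = s1 + s2 - s3 - s4.
      by ring.
    rewrite -big_split/= -!sumrB; apply: eq_bigr => i _.
    have -> : conjc (d i) = (conjc z - (be i)%:C)^-1 - (w - (be i)%:C)^-1.
      by rewrite /d conjcB conjcK conjc_inv conjc_subr.
    rewrite /d conjc_inv conjc_subr.
    by field; rewrite !subC_neq0 ?Imc// gt_eqF.
  (* After multiplication by 1 - t, each of the four slopes equals 1, and 1 + 1 - 1 - 1 = 0. *)
  by apply: (mulfI t1); rewrite mulr0 !mulrBr mulrDr !conj1// zw1 zw1'; ring.
have {}d0 i : d i = 0.
  have : (c i)%:C * (d i * conjc (d i)) = 0.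
    apply: (psumr_eq0P _ d0) => // j _; apply: mulr_ge0; last exact: mulcJ_ge0.
    by rewrite ler0c ltW.
  move/eqP; rewrite !mulf_eq0 conjc_eq0 orbb => /orP[|/eqP//].
  by move=> /eqP [] ci; have := c_gt0 i; rewrite ci ltxx.
have [i|m0] := pickP (fun _ : 'I_m => true).
  move: (d0 i) => /subr0_eq.
  rewrite conjc_inv conjc_subr => /invr_inj/addIr/eqP.
  by rewrite (negPf (upper_neq_conj z0 w0)).
(* For m = 0 the sum of squares is empty, but the slope is then 1, so that 1 - t = 1, against
   [t != 0]. *)
move: zw1; rewrite /stieltjes_slope big1 => [|i _]; last first.
  by have := m0 i.
rewrite addr0 mulr1 => -[t10]; move/eqP: t0; lra.
Qed.

(** At t = 0 the slope at [z] and its conjugate is 1, so a sum of positive terms vanishes and must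
    be empty. The equation then reads x = k, whatever the unknown. This serves to exclude t = 0 from
    the liquid region. *)
Lemma hodograph_t0 (x : R) (z w : R[i]) :
  0 < complex.Im z -> hodograph x 0 z -> hodograph x 0 w.
Proof.
move=> z0 hz; have zi : complex.Im z != 0 by rewrite gt_eqF.
have zci : complex.Im (conjc z) != 0.
  by case: z zi {z0 hz} => ? ? /=; rewrite oppr_eq0.
have := hodograph_slope zi zci (upper_neq_conj z0 z0) hz (hodograph_conj hz).
rewrite subr0 mul1r => /(canRL (addKr _)); rewrite addNr => sum0.
have I0 (i : 'I_m) : False.
  have term_ge0 j : true ->
      0 <= (c j)%:C / ((z - (be j)%:C) * (conjc z - (be j)%:C)).
    by move=> _; rewrite -conjc_subr divr_ge0 ?mulcJ_ge0// ler0c ltW.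
  have /eqP := @psumr_eq0P _ _ _ _ term_ge0 sum0 i isT.
  rewrite mulf_eq0 invr_eq0 mulf_eq0 !(negPf (subC_neq0 _ _))// !orbF.
  move=> /eqP[ci].
  by have := c_gt0 i; rewrite ci ltxx.
move: hz; rewrite /hodograph /stieltjes subr0 !mul1r.
do 2![rewrite [\sum_i _]big1; last by move=> i; case: (I0 i)].
by rewrite !subr0 => /addrI ->.
Qed.

Lemma hodograph_uniq (x t : R) (z w : R[i]) : t != 0 ->
  0 < complex.Im z -> 0 < complex.Im w ->
  hodograph x t z -> hodograph x t w -> z = w.
Proof.
move=> t0 z0 w0 hz hw; have [//|zw] := eqVneq z w.
have := hodograph_slope_neq1 t0 z0 w0 hz hw.
by rewrite (hodograph_slope _ _ _ hz hw) ?eqxx// gt_eqF.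
Qed.

End Stieltjes.

(** * The ratio of the two products as the function [G] *)

Section StieltjesForm.
Local Open Scope complex_scope.

(** The real partial fraction identity is carried to [R[i]] and evaluated at [z]. Since [G]
    subtracts its sum, the weights are the negated residues, hence positive. *)
Lemma stieltjes_form (R : realType) m (al : 'I_m.+1 -> R) (be : 'I_m -> R) :
  (forall i, al (widen_ord (leqnSn m) i) < be i < al (lift ord0 i)) ->
  exists k (c : 'I_m -> R), (forall i, 0 < c i) /\
  forall z : R[i], complex.Im z != 0 ->
    \prod_i (z - (al i)%:C) = stieltjes k c be z * \prod_i (z - (be i)%:C).
Proof.
move=> ab; have [k pq] := partial_fractions al (interlacing_inj ab).
exists k, (fun i =>
  - (\prod_j (be i - al j) / \prod_(j | j != i) (be i - be j))).
split=> [i|z z0]; first by rewrite oppr_gt0 prod_interlacing_lt0.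
have := congr1 (fun p => (map_poly (real_complex R) p).[z]) pq.
rewrite rmorphD/= rmorphM/= rmorph_sum/= !map_prod_XsubC map_polyXsubC.
rewrite !hornerE horner_sum horner_prod => /eqP.
rewrite !horner_prod.
move=> /eqP; under eq_bigr do rewrite hornerXsubC.
move=> ->; under [X in _ * X]eq_bigr do rewrite hornerXsubC.
rewrite /stieltjes [RHS]mulrBl; congr (_ + _).
rewrite mulr_suml -sumrN; apply: eq_bigr => i _.
rewrite map_polyZ map_prod_XsubC hornerZ horner_prod.
rewrite [X in _ * X](eq_bigr (fun j => z - (be j)%:C)) => [|j _]; last first.
  by rewrite hornerXsubC.
rewrite rmorphN !mulNr opprK [X in _ = _ * X](bigD1 i)//=.
rewrite mulrA divfK//.
exact: subC_neq0.
Qed.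

End StieltjesForm.

(** * Limits in [R[i]] along a filter *)

Section ComplexLimits.
Context {R : realType} {T : Type} (F : set_system T) {FF : Filter F}.
Local Open Scope complex_scope.
Implicit Types (f g : T -> R[i]) (z w : R[i]).

(** Componentwise, to match [cderivable] and [cderive]. *)
Definition ccvg f z : Prop :=
  (complex.Re (f y) @[y --> F] --> complex.Re z) /\
  (complex.Im (f y) @[y --> F] --> complex.Im z).

Lemma ccvg_cst z : ccvg (fun=> z) z.
Proof. by split; apply: cvg_cst. Qed.

Lemma ccvg_real (f : T -> R) (r : R) : f y @[y --> F] --> r ->
  ccvg (fun y => (f y)%:C) r%:C.
Proof. by split=> //; apply: cvg_cst. Qed.

Lemma eq_ccvg f g z : {near F, f =1 g} -> ccvg f z -> ccvg g z.
Proof.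
move=> fg [fr fi]; split.
  by apply: cvg_trans fr; apply: near_eq_cvg; apply: filterS fg => y ->.
by apply: cvg_trans fi; apply: near_eq_cvg; apply: filterS fg => y ->.
Qed.

Lemma ccvgD f g z w : ccvg f z -> ccvg g w -> ccvg (fun y => f y + g y) (z + w).
Proof.
have ReD (u v : R[i]) : complex.Re (u + v) = complex.Re u + complex.Re v.
  by case: u; case: v.
have ImD (u v : R[i]) : complex.Im (u + v) = complex.Im u + complex.Im v.
  by case: u; case: v.
move=> [fr fi] [gr gi]; split.
  by rewrite ReD; under eq_fun do rewrite ReD; apply: cvgD.
by rewrite ImD; under eq_fun do rewrite ImD; apply: cvgD.
Qed.

Lemma ccvgM f g z w : ccvg f z -> ccvg g w -> ccvg (fun y => f y * g y) (z * w).
Proof.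
have ReM (u v : R[i]) : complex.Re (u * v) =
  complex.Re u * complex.Re v - complex.Im u * complex.Im v.
  by case: u; case: v.
have ImM (u v : R[i]) : complex.Im (u * v) =
  complex.Re u * complex.Im v + complex.Im u * complex.Re v.
  by case: u; case: v.
move=> [fr fi] [gr gi]; split.
  by rewrite ReM; under eq_fun do rewrite ReM; apply: cvgB; apply: cvgM.
by rewrite ImM; under eq_fun do rewrite ImM; apply: cvgD; apply: cvgM.
Qed.

Lemma ccvgB f g z w : ccvg f z -> ccvg g w -> ccvg (fun y => f y - g y) (z - w).
Proof.
move=> fz gw; rewrite -mulN1r; under eq_fun do rewrite -mulN1r.
exact/ccvgD/ccvgM/gw/ccvg_cst.
Qed.

Lemma ccvg_neq0 f z : ccvg f z -> z != 0 -> \forall y \near F, f y != 0.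
Proof.
move=> [fr fi] z0.
have [Re0|Re0] := eqVneq (complex.Re z) 0.
  have Im0 : complex.Im z != 0.
    by apply: contra z0 => /eqP; case: z Re0 {fr fi} => r i /= -> ->.
  by apply: filterS (cvgr_neq0 _ fi Im0) => y; apply: contraNneq => ->.
by apply: filterS (cvgr_neq0 _ fr Re0) => y; apply: contraNneq => ->.
Qed.

Lemma ccvgV f z : z != 0 -> ccvg f z -> ccvg (fun y => (f y)^-1) z^-1.
Proof.
have ReV (u : R[i]) : complex.Re u^-1 =
  complex.Re u / (complex.Re u ^+ 2 + complex.Im u ^+ 2) by case: u.
have ImV (u : R[i]) : complex.Im u^-1 =
  - (complex.Im u / (complex.Re u ^+ 2 + complex.Im u ^+ 2)) by case: u.
move=> z0 [fr fi].
have N0 : complex.Re z ^+ 2 + complex.Im z ^+ 2 != 0.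
  rewrite paddr_eq0 ?sqr_ge0// !sqrf_eq0; apply: contra z0 => /andP[].
  by case: z {fr fi} => a b /= /eqP -> /eqP ->.
have N : ((complex.Re (f y) ^+ 2 + complex.Im (f y) ^+ 2)^-1) @[y --> F] -->
    (complex.Re z ^+ 2 + complex.Im z ^+ 2)^-1.
  by apply: cvgV => //; rewrite !expr2; apply: cvgD; apply: cvgM.
split.
  by rewrite ReV; under eq_fun do rewrite ReV; apply: cvgM.
by rewrite ImV; under eq_fun do rewrite ImV; apply: cvgN; apply: cvgM.
Qed.

Lemma ccvg_sum m (f : 'I_m -> T -> R[i]) (z : 'I_m -> R[i]) :
  (forall i, ccvg (f i) (z i)) ->
  ccvg (fun y => \sum_i f i y) (\sum_i z i).
Proof.
elim: m f z => [|m IH] f z fz.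
  by rewrite big_ord0; under eq_fun do rewrite big_ord0; apply: ccvg_cst.
rewrite big_ord_recl; under eq_fun do rewrite big_ord_recl.
by apply: ccvgD => //; apply: IH.
Qed.

Lemma ccvg_prod m (f : 'I_m -> T -> R[i]) (z : 'I_m -> R[i]) :
  (forall i, ccvg (f i) (z i)) ->
  ccvg (fun y => \prod_i f i y) (\prod_i z i).
Proof.
elim: m f z => [|m IH] f z fz.
  by rewrite big_ord0; under eq_fun do rewrite big_ord0; apply: ccvg_cst.
rewrite big_ord_recl; under eq_fun do rewrite big_ord_recl.
by apply: ccvgM => //; apply: IH.
Qed.

End ComplexLimits.

(** * Roots near a point where a polynomial is small *)

Section SquaredModulus.
Context {R : realType}.
Local Open Scope complex_scope.

(** The squared modulus takes values in [R] and avoids square roots while remaining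
    multiplicative. *)
Definition sqmod (z : R[i]) : R := complex.Re z ^+ 2 + complex.Im z ^+ 2.

Lemma sqmodM (z w : R[i]) : sqmod (z * w) = sqmod z * sqmod w.
Proof. by case: z w => [a b] [a' b']; rewrite /sqmod/=; ring. Qed.

Lemma sqmod_ge0 (z : R[i]) : 0 <= sqmod z.
Proof. by rewrite addr_ge0 ?sqr_ge0. Qed.

(** Factor [p] over its roots: if all of them were at squared distance at least [e] from [z], the
    product would be too large. *)
Lemma exists_near_root (p : {poly R[i]}) (z : R[i]) (e : R) :
  p != 0 -> 0 <= e ->
  sqmod p.[z] < sqmod (lead_coef p) * e ^+ (size p).-1 ->
  exists2 w, root p w & sqmod (z - w) < e.
Proof.
move=> p0 e0; have [s ps] := closed_field_poly_normal p.
have l0 : lead_coef p != 0 by rewrite lead_coef_eq0.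
have pz : p.[z] = lead_coef p * \prod_(w <- s) (z - w).
  rewrite {1}ps hornerZ horner_prod; congr (_ * _).
  by apply: eq_bigr => w _; rewrite hornerXsubC.
have -> : (size p).-1 = size s by rewrite ps size_scale// size_prod_XsubC.
rewrite pz sqmodM => H.
apply: contrapT => nw.
have se w : w \in s -> e <= sqmod (z - w).
  move=> ws; rewrite leNgt; apply/negP => we; apply: nw; exists w => //.
  by rewrite ps rootZ// root_prod_XsubC.
move: H; apply/negP; rewrite -leNgt ler_wpM2l ?sqmod_ge0//.
elim: s se {ps pz} => [|w s IH] se; first by rewrite big_nil /sqmod/=; lra.
rewrite big_cons sqmodM exprS ler_pM// ?exprn_ge0//.
  by rewrite se// mem_head.
by apply: IH => v vs; rewrite se// inE vs orbT.
Qed.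

End SquaredModulus.

Lemma ImDC (R : pzRingType) (x : R) (U : R[i]) :
  complex.Im (x%:C%C + U) = complex.Im U.
Proof. by case: U => r i /=; rewrite add0r. Qed.

(** * Continuity and difference quotients of the critical root *)

Section CriticalRoot.
Context {R : realType} (eta : R) {m : nat}.
Context (a : 'I_m.+1 -> int) (b : 'I_m -> int).
Local Open Scope complex_scope.
Let al i : R := eta * (a i)%:~R.
Let be i : R := eta * (b i)%:~R.

Definition critical_poly (x t : R) : {poly R[i]} :=
  'X * \prod_(i < m) ('X - ((be i - x)%:C)%:P) -
  (1 - t)%:C *: \prod_(i < m.+1) ('X - ((al i - x)%:C)%:P).

Lemma horner_critical_poly (x t : R) (U : R[i]) :
  (critical_poly x t).[U] =
  U * \prod_(i < m) ((x - be i)%:C + U) -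
  (1 - t)%:C * \prod_(i < m.+1) ((x - al i)%:C + U).
Proof.
have E n (f : 'I_n -> R) : (\prod_i ('X - ((f i - x)%:C)%:P)).[U] =
    \prod_i ((x - f i)%:C + U).
  rewrite horner_prod; apply: eq_bigr => i _.
  by rewrite hornerXsubC -rmorphN opprB addrC.
by rewrite /critical_poly hornerD hornerN hornerM hornerX hornerZ !E.
Qed.

Lemma critical_poly_root (x t : R) (U : R[i]) :
  root (critical_poly x t) U -> critical_equation eta a b x t U.
Proof. by rewrite /root horner_critical_poly subr_eq0 => /eqP. Qed.

(** Two monic polynomials of degree m + 1 enter with coefficients 1 and -(1 - t), which add up to
    t. *)
Lemma size_critical_poly (x t : R) : t != 0 ->
  size (critical_poly x t) = m.+2 /\ lead_coef (critical_poly x t) = t%:C.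
Proof.
move=> t0; rewrite /critical_poly.
set q := \prod_(i < m) _; set p := \prod_(i < m.+1) _.
have sp : size p = m.+2.
  by rewrite size_prod_XsubC /index_enum -enumT size_enum_ord.
have sq : size q = m.+1.
  by rewrite size_prod_XsubC /index_enum -enumT size_enum_ord.
have mp : p \is monic by apply: monic_prod_XsubC.
have mq : 'X * q \is monic by rewrite monicMl ?monicX// monic_prod_XsubC.
have sXq : size ('X * q) = m.+2.
  by rewrite mulrC size_mulX ?sq// -size_poly_gt0 sq.
have top : ('X * q - (1 - t)%:C *: p)`_m.+1 = t%:C.
  rewrite coefB coefZ.
  move/monicP: mp; rewrite lead_coefE sp => ->.
  move/monicP: mq; rewrite lead_coefE sXq => ->.
  by rewrite rmorphB rmorph1 mulr1; ring.
have sz : size ('X * q - (1 - t)%:C *: p) = m.+2.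
  apply/eqP; rewrite eqn_leq; apply/andP; split.
    apply: (leq_trans (size_polyD _ _)); rewrite size_polyN geq_max sXq leqnn/=.
    by rewrite (leq_trans (size_scale_leq _ _)) ?sp.
  rewrite ltnNge; apply/negP => /leq_sizeP /(_ _ (leqnn _)).
  by rewrite top => -[/eqP]; rewrite (negPf t0).
by rewrite lead_coefE sz.
Qed.

(** The perturbed polynomial tends to 0 at [U] while its leading coefficient tends to [t], which is
    nonzero; hence it has a root near [U]. *)
Lemma near_critical_solution {T : Type} (F : set_system T) {FF : Filter F}
    (X S : T -> R) (x t : R) (U : R[i]) (e : R) :
  X y @[y --> F] --> x -> S y @[y --> F] --> t -> t != 0 -> 0 < e ->
  critical_equation eta a b x t U ->
  \forall y \near F, exists2 V, critical_equation eta a b (X y) (S y) V &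
    sqmod (U - V) < e.
Proof.
move=> Xx St t0 e0 /eqP; rewrite -subr_eq0 => /eqP crit.
have [lim0r lim0i] : ccvg F (fun y => (critical_poly (X y) (S y)).[U]) 0.
  rewrite -crit; under eq_fun do rewrite horner_critical_poly.
  by apply: ccvgB; (apply: ccvgM;
    [exact: ccvg_cst || (apply: ccvg_real; apply: cvgB => //; exact: cvg_cst)
    |apply: ccvg_prod => i; apply: ccvgD; last exact: ccvg_cst;
     apply: ccvg_real; apply: cvgB => //; exact: cvg_cst]).
(* This is the gap in the hypothesis of [exists_near_root], for leading coefficient [S y] and degree
   m + 1; its limit is positive. *)
have : (S y * S y * e ^+ m.+1 - sqmod (critical_poly (X y) (S y)).[U])
    @[y --> F] --> t * t * e ^+ m.+1 - (0 * 0 + 0 * 0).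
  apply: cvgB; first by apply: cvgM; [exact: cvgM|exact: cvg_cst].
  by rewrite /sqmod; under eq_fun do rewrite !expr2; apply: cvgD; apply: cvgM.
rewrite mul0r addr0 subr0 => /(cvgr_gt _) gt0.
have {}gt0 := gt0 0 _.
have pos : 0 < t * t * e ^+ m.+1.
  by rewrite mulr_gt0 ?exprn_gt0// -expr2 exprn_even_gt0.
have S0 : \forall y \near F, S y != 0 by apply: cvgr_neq0 t0.
apply: (filterS2 _ _ (gt0 pos) S0) => {S0} y; rewrite subr_gt0 => lty S0.
have [sz lc] := size_critical_poly (X y) S0.
have [||V rV UV] :=
  @exists_near_root _ (critical_poly (X y) (S y)) U e _ (ltW e0).
- by rewrite -size_poly_gt0 sz.
- by rewrite sz lc /sqmod/= expr0n/= addr0 expr2.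
- by exists V => //; apply: critical_poly_root.
Qed.

Hypothesis ab : forall i, al (widen_ord (leqnSn m) i) < be i < al (lift ord0 i).

(** The product of the z - [be i] is nonzero at nonreal z and can be cancelled. The same [k] and [c]
    serve all [x] and [t]. *)
Lemma critical_hodograph : exists k (c : 'I_m -> R), (forall i, 0 < c i) /\
  forall x t (U : R[i]), complex.Im U != 0 ->
    critical_equation eta a b x t U <-> hodograph k c be x t (x%:C + U).
Proof.
have [k [c [c0 form]]] := stieltjes_form ab; exists k, c; split=> // x t U U0.
have z0 : complex.Im (x%:C + U) != 0 by rewrite ImDC.
have E n (f : 'I_n -> R) :
    \prod_i ((x - f i)%:C + U) = \prod_i (x%:C + U - (f i)%:C).
  by apply: eq_bigr => i _; rewrite rmorphB/= addrAC.
rewrite /critical_equation /hodograph !E (form _ z0) mulrA addrAC subrr add0r.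
have q0 : \prod_i (x%:C + U - (be i)%:C) != 0.
  by apply/prodf_neq0 => i _; apply: subC_neq0.
by split=> [/(mulIf q0)|{1}->].
Qed.

(** Uniqueness identifies any solution found in the upper half-plane with the selected root, in
    particular at perturbed parameters. *)
Lemma critical_root_eq (x t : R) (U : R[i]) : t != 0 -> 0 < complex.Im U ->
  critical_equation eta a b x t U -> critical_root eta a b x t = U.
Proof.
move=> t0 U0 eU; have [k [c [c0 crit]]] := critical_hodograph.
apply: xget_unique => // V [eV V0]; apply: (addrI x%:C).
apply: (@hodograph_uniq R m k c be c0 x t) ;
  rewrite ?ImDC//; by apply/crit => //; rewrite gt_eqF.
Qed.

(** At t = 0 the root shifted by ['i] would be a second solution in the upper half-plane. *)
Lemma liquid_neq0 (x t : R) : liquid_region eta a b (x, t) -> t != 0.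
Proof.
move=> L; apply/eqP => t0; move: L; rewrite {}t0 => L.
have [[eU U0] uniqU] := critical_rootP L.
have [k [c [c0 crit]]] := critical_hodograph.
have V0 : 0 < complex.Im (critical_root eta a b x 0 + 'i).
  by case: (critical_root _ _ _ _ _) U0 => ? ? /= /ltr_wpDr; exact.
suff : critical_root eta a b x 0 = critical_root eta a b x 0 + 'i.
  by case: (critical_root _ _ _ _ _) => ? ? [_] /eqP; rewrite -subr_eq0; lra.
apply: uniqU; split => //; apply/crit; first by rewrite gt_eqF.
move/crit: eU; rewrite gt_eqF// => /(_ isT).
by apply: (hodograph_t0 c0); rewrite ImDC.
Qed.

Lemma critical_root_cvg {T : Type} (F : set_system T) {FF : Filter F}
    (X S : T -> R) (x t : R) (U : R[i]) :
  X y @[y --> F] --> x -> S y @[y --> F] --> t -> t != 0 ->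
  0 < complex.Im U -> critical_equation eta a b x t U ->
  (\forall y \near F,
    critical_equation eta a b (X y) (S y) (critical_root eta a b (X y) (S y)) /\
    0 < complex.Im (critical_root eta a b (X y) (S y))) /\
  ccvg F (fun y => critical_root eta a b (X y) (S y)) U.
Proof.
move=> Xx St t0 U0 eU.
have S0 : \forall y \near F, S y != 0 by apply: cvgr_neq0 t0.
have near_root e : 0 < e -> \forall y \near F,
    [/\ critical_equation eta a b (X y) (S y)
          (critical_root eta a b (X y) (S y)),
        0 < complex.Im (critical_root eta a b (X y) (S y)) &
        sqmod (U - critical_root eta a b (X y) (S y)) < e].
  (* A solution closer to [U] than its imaginary part stays in the upper half-plane, so it is the
     critical root there. *)
  move=> e0; have me : 0 < Num.min e (complex.Im U ^+ 2).
    by rewrite lt_min e0 exprn_gt0.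
  apply: (filterS2 _ _ S0 (near_critical_solution Xx St t0 me eU)).
  move=> y Sy0 [V eV]; rewrite lt_min => /andP[Ve VI].
  have V0 : 0 < complex.Im V.
    move: VI U0; case: (U) (V) => [u u'] [v v']; rewrite /sqmod/= => VI u0.
    rewrite ltNge; apply/negP => v0.
    have := sqr_ge0 (u - v); have := sqr_ge0 v'.
    have : 0 <= u' * - v' by rewrite mulr_ge0 ?oppr_ge0// ltW.
    by nra.
  by rewrite (critical_root_eq Sy0 V0 eV).
split; first by apply: filterS (near_root 1 ltr01) => y [].
have sqr_lt (r e : R) : 0 < e -> r ^+ 2 < e ^+ 2 -> `|r| < e.
  by move=> e0; rewrite -(real_normK (num_real r)) ltr_pXn2r// nnegrE// ltW.
split; apply/cvgrPdist_lt => e e0;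
  apply: filterS (near_root (e ^+ 2) (exprn_gt0 _ e0)) => y [_ _ Ve];
  apply: sqr_lt => //; apply: le_lt_trans Ve;
  case: (U) (critical_root eta a b (X y) (S y)) => [u u'] [v v'];
  by rewrite /sqmod/= ?lerDl ?lerDr sqr_ge0.
Qed.

(* [G] is the value at [x + U] of the function [G] of the header. *)
Lemma critical_root_directional (x t : R) : liquid_region eta a b (x, t) ->
  exists G D : R[i], [/\ D != 0, critical_root eta a b x t = (1 - t)%:C * G &
  forall v w : R, ccvg (0 : R)^'
    (fun h : R => (h^-1)%:C * (critical_root eta a b (h * v + x) (h * w + t) -
                           critical_root eta a b x t))
    ((v%:C - w%:C * G) / D - v%:C)].
Proof.
move=> L; have t0 := liquid_neq0 L.
have [[eU U0] _] := critical_rootP L.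
have [k [c [c0 crit]]] := critical_hodograph.
set U := critical_root eta a b x t in eU U0 *.
pose z := x%:C + U.
have z0 : 0 < complex.Im z by rewrite ImDC.
have hz : hodograph k c be x t z by apply/crit => //; rewrite gt_eqF.
pose G := stieltjes k c be z.
(* Nonzero because [z] is a simple solution: the diagonal case of [hodograph_slope_neq1]. *)
pose D := 1 - (1 - t)%:C * stieltjes_slope c be z z.
have D0 : D != 0.
  by rewrite subr_eq0 eq_sym; exact: (hodograph_slope_neq1 c0 t0 z0 z0 hz hz).
exists G, D; split=> // [|v w]; first by rewrite -hz /z addrAC subrr add0r.
have lin (u y : R) : (h * u + y) @[h --> (0 : R)^'] --> y.
  suff : (h * u + y) @[h --> (0 : R)^'] --> 0 * u + y by rewrite mul0r add0r.
  apply: cvg_within_filter.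
  by apply: cvgD; [apply: cvgM; [exact: cvg_id|exact: cvg_cst]|exact: cvg_cst].
have [near_crit Ucvg] := critical_root_cvg (lin v x) (lin w t) t0 U0 eU.
pose V (h : R) := critical_root eta a b (h * v + x) (h * w + t).
pose Z (h : R) := (h * v + x)%:C + V h.
pose E (h : R) := 1 - (1 - (h * w + t))%:C * stieltjes_slope c be (Z h) z.
have Zcvg : ccvg (0 : R)^' Z z by apply: ccvgD Ucvg; exact/ccvg_real/lin.
have Ecvg : ccvg (0 : R)^' E D.
  apply: ccvgB; first exact: ccvg_cst.
  apply: ccvgM.
    by apply: ccvg_real; apply: cvgB; [exact: cvg_cst|exact: lin].
  apply: ccvgD; first exact: ccvg_cst.
  apply: ccvg_sum => i; apply: ccvgM; first exact: ccvg_cst.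
  apply: ccvgV; first by rewrite mulf_neq0// subC_neq0// gt_eqF.
  apply: ccvgM; last exact: ccvg_cst.
  by apply: ccvgB Zcvg _; exact: ccvg_cst.
have E0 : \forall h \near (0 : R)^', h != 0 /\ E h != 0.
  by apply: (filterS2 _ _ (nbhs_dnbhs_neq 0) (ccvg_neq0 Ecvg D0)).
have lim : ccvg (0 : R)^' (fun h => (v%:C - w%:C * G) / E h - v%:C)
    ((v%:C - w%:C * G) / D - v%:C).
  apply: ccvgB; last exact: ccvg_cst.
  by apply: ccvgM; [exact: ccvg_cst|exact: ccvgV].
apply: eq_ccvg lim; apply: (filterS2 _ _ E0 near_crit) => h [h0 Eh0] [eV V0].
have Z0 : 0 < complex.Im (Z h) by rewrite ImDC.
have hZ : hodograph k c be (h * v + x) (h * w + t) (Z h).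
  by apply/crit => //; rewrite gt_eqF.
(* Subtract the equations at [Z h] and [z], and replace the increment of [G] by (Z h - z) times the
   slope; what remains is linear in [h]. *)
have key : (Z h - z) * E h = h%:C * (v%:C - w%:C * G).
  have [Zi zi] : complex.Im (Z h) != 0 /\ complex.Im z != 0 by rewrite !gt_eqF.
  rewrite /E mulrBr mulr1 mulrCA -(stieltjesB k c be Zi zi) mulrBr -hZ -/G.
  have -> : z = x%:C + (1 - t)%:C * G by rewrite -hz addrC subrK.
  by rewrite !rmorphB !rmorphD !rmorphM rmorph1; ring.
have hC0 : h%:C != 0 by rewrite (fmorph_eq0 (real_complex R)).
have -> : critical_root eta a b (h * v + x) (h * w + t) - U =
    Z h - z - h%:C * v%:C.
  by rewrite /Z /z /V rmorphD rmorphM; ring.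
rewrite -[Z h - z](mulfK Eh0) key fmorphV.
by field; rewrite Eh0 hC0.
Qed.

End CriticalRoot.

(** * Partial derivatives and the differential equation *)

Lemma ccvg_cderive (R : realType) (f : R -> R[i]) (y : R) (l : R[i]) :
  ccvg (0 : R)^' (fun h : R => (h^-1)%:C%C * (f (h + y) - f y)) l ->
  cderivable f y /\ cderive f y = l.
Proof.
have ReZ (r : R) (z w : R[i]) : complex.Re (r%:C%C * (z - w)) =
    r *: (complex.Re z - complex.Re w).
  by case: z; case: w => ? ? ? ? /=; rewrite mul0r subr0.
have ImZ (r : R) (z w : R[i]) : complex.Im (r%:C%C * (z - w)) =
    r *: (complex.Im z - complex.Im w).
  by case: z; case: w => ? ? ? ? /=; rewrite mul0r addr0.
move=> [fr fi].
have {}fr : (h^-1 *: (complex.Re (f (h + y)) - complex.Re (f y)))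
    @[h --> (0 : R)^'] --> complex.Re l by under eq_fun do rewrite -ReZ.
have {}fi : (h^-1 *: (complex.Im (f (h + y)) - complex.Im (f y)))
    @[h --> (0 : R)^'] --> complex.Im l by under eq_fun do rewrite -ImZ.
split; last first.
  by rewrite /cderive; case: l fr fi => ? ? /= fr fi; congr Complex;
    apply/cvg_lim.
split; rewrite /derivable.
  by under eq_fun do rewrite /= [_ *: 1]mulr1; apply: cvgP fr.
by under eq_fun do rewrite /= [_ *: 1]mulr1; apply: cvgP fi.
Qed.

Theorem proposition20 (R : realType) (la : seq nat)
    (la_part : is_partition la) (la_neq0 : la != [::])
    (m : nat) (a : 'I_m.+1 -> int) (b : 'I_m -> int)
    (ab_la : interlacing_coordinates R la a b) :
  let eta : R := scaling R la in
  let Uc : R -> R -> R[i] := critical_root eta a b in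
  forall x t : R, liquid_region eta a b (x, t) ->
  let Uc_x := cderive (fun y => Uc y t) x in
  let Uc_t := cderive (fun s => Uc x s) t in
  [/\ cderivable (fun y => Uc y t) x,
      cderivable (fun s => Uc x s) t &
      Uc_t + Uc x t * ((Uc_x + 1) / (1 - t)%:C%C) = 0].
Proof.
move=> eta Uc x t L Uc_x Uc_t.
(* A nonempty partition has a nonzero first part, hence positive size; scaling by [eta] then
   preserves the interlacing. *)
have eta0 : 0 < eta.
  rewrite invr_gt0 sqrtr_gt0 ltr0n.
  case: la la_part la_neq0 {ab_la eta Uc x t L Uc_x Uc_t} => // n la.
  by rewrite /is_partition inE negb_or => /and3P[_ n0 _] _ /=; lia.
have ab i : eta * (a (widen_ord (leqnSn m) i))%:~R < eta * (b i)%:~R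
    < eta * (a (lift ord0 i))%:~R.
  case: ab_la => /(_ i) /andP[ab1 ab2] _ _.
  by rewrite !ltr_pM2l// !ltr_int ab1.
have [G [D [D0 UG quot]]] := critical_root_directional ab L.
have [dx Ux] : cderivable (fun y => Uc y t) x /\ Uc_x = 1 / D - 1.
  apply: ccvg_cderive; have := quot 1 0; rewrite mul0r subr0.
  by under eq_fun do rewrite mulr1 mulr0 add0r.
have [dt Ut] : cderivable (fun s => Uc x s) t /\ Uc_t = - G / D.
  apply: ccvg_cderive; have := quot 0 1; rewrite mul1r sub0r subr0.
  by under eq_fun do rewrite mulr1 mulr0 add0r.
(* Since U = (1 - t) G has positive imaginary part, 1 - t cannot vanish. *)
have t1 : (1 - t)%:C%C != 0.
  have [[_ U0] _] := critical_rootP L.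
  by apply/eqP => t1; move: U0; rewrite UG t1 mul0r ltxx.
split=> //; rewrite Ux Ut /Uc UG.
(* With U = (1 - t) G and U_x + 1 = 1 / D, the second term is G / D, the opposite of U_t. *)
by move: (1 - t)%:C%C t1 => s s0; field; rewrite s0 D0.
Qed.
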